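(* Causal equivalence $\equiv_{caus}$ does not respect inevitability: there exist nets $N_1$ and $N_2$ with $N_1\equiv_{caus}N_2$ and an action $b$ that is inevitable in one of them but not in the other.
   Context: Petri nets: $N=(S,T,F,M_0,A,\ell)$ with disjoint sets $S$ (places), $T$ (transitions), $F:(S\times T)\cup(T\times S)\to\mathbb N$, initial marking $M_0\in\mathbb N^S$, type $A$, labelling $\ell:T\to A$; ${}^\bullet x(y)=F(y,x)$, $x^\bullet(y)=F(x,y)$; $t$ enabled at $M$ iff ${}^\bullet t\le M$, firing yields $M-{}^\bullet t+t^\bullet$; reachable markings arise from $M_0$ by finite firing sequences. A net is a Petri net with bounded parallelism (no reachable $M$ and multiset $U$ of transitions with infinitely many elements with $\sum_{t\in U}{}^\bullet t\le M$). Processes: a causal net is a net $\mathcal N=(\mathcal S,\mathcal T,\mathcal F,\mathcal M_0,\mathcal A,\ell_{\mathcal N})$ in which every place has at most one pre- and at most one post-transition, $\mathcal M_0(s)=1$ iff $s$ has no pre-transition (else 0), the transitive closure $\mathcal F^+$ of the flow is irreflexive, and every transition has finitely many $\mathcal F^+$-predecessor transitions. A folding into $N$ maps places to places, transitions to transitions, with $\mathcal A=A$, labels preserved, $\rho(\mathcal M_0)=M_0$, $\rho({}^\bullet t)={}^\bullet\rho(t)$, $\rho(t^\bullet)=\rho(t)^\bullet$ (where $\rho(H)(s)=|\rho^{-1}(s)\cap H|$). A process of $N$ is a pair (causal net, folding into $N$). A process $\mathcal P'$ is a prefix of $\mathcal P$ ($\mathcal P$ extends $\mathcal P'$) iff its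 places and transitions are subsets of those of $\mathcal P$, the initial markings coincide, its flow and folding are the restrictions of those of $\mathcal P$. A causal net of $N$ is the first component of a process of $N$; $N_1\equiv_{caus}N_2$ iff they have the same causal nets. Inevitability (assuming justness but no fairness): a process is complete iff it is maximal, i.e. has no proper extension. An action $b$ is inevitable in $N$ iff every complete process of $N$ contains a transition labelled $b$. An equivalence $\approx$ respects inevitability iff whenever $N_1\approx N_2$ and $b$ is inevitable in $N_1$, then $b$ is inevitable in $N_2$. *)

(* Defs.v *)
From mathcomp Require Import all_boot.
From mathcomp Require Import boolp classical_sets functions cardinality.
From Stdlib Require Import Relation_Operators.

Set Implicit Arguments.
Unset Strict Implicit.
Unset Printing Implicit Defensive.

Local Open Scope classical_set_scope.
Local Open Scope card_scope.

(* A multiset over X is a function H : X -> nat.  Its occurrences are the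
   pairs (x, k) with k < H x; their number is the size of H, counted with
   multiplicity and possibly infinite. *)
Definition occurrences (X : Type) (H : X -> nat) : set (X * nat) :=
  [set o | (o.2 < H o.1)%N].

(* Places and transitions are separate types, so they are disjoint; F is split
   into F(s, t) = [flowPT s t] and F(t, s) = [flowTP t s].  The type A of a net
   is a parameter. *)
Record petri_net (A : Type) := PetriNet {
  place : Type;
  trans : Type;
  flowPT : place -> trans -> nat;
  flowTP : trans -> place -> nat;
  init : place -> nat;
  label : trans -> A }.

Section PetriNets.
Variables (A : Type) (N : petri_net A).

Definition preT (t : trans N) : place N -> nat := fun s => flowPT s t.
Definition postT (t : trans N) : place N -> nat := fun s => flowTP t s.
Definition preP (s : place N) : trans N -> nat := fun t => flowTP t s.
Definition postP (s : place N) : trans N -> nat := fun t => flowPT s t.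

Definition enabled (M : place N -> nat) (t : trans N) : Prop :=
  forall s, (preT t s <= M s)%N.

Definition fire (M : place N -> nat) (t : trans N) : place N -> nat :=
  fun s => (M s - preT t s + postT t s)%N.

Inductive reachable : (place N -> nat) -> Prop :=
| reachable_init : reachable (@init A N)
| reachable_fire M t : reachable M -> enabled M t -> reachable (fire M t).

(* sum_(t in U) preT t <= M.  At s, the sum over the possibly infinite type of
   transitions is the size of the multiset t |-> U t * preT t s. *)
Definition step_enabled (M : place N -> nat) (U : trans N -> nat) : Prop :=
  forall s, occurrences (fun t => U t * preT t s)%N #<= `I_(M s).

Definition bounded_parallelism : Prop :=
  ~ exists (M : place N -> nat) (U : trans N -> nat),
      [/\ reachable M, infinite_set (occurrences U) & step_enabled M U].

Definition flow (x y : place N + trans N) : Prop :=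
  match x, y with
  | inl s, inr t => (0 < flowPT s t)%N
  | inr t, inl s => (0 < flowTP t s)%N
  | _, _ => False
  end.

Definition flow_plus : place N + trans N -> place N + trans N -> Prop :=
  clos_trans _ flow.

End PetriNets.

Record net (A : Type) := Net {
  net_petri :> petri_net A;
  net_bounded : bounded_parallelism net_petri }.

Section Processes.
Variable A : Type.

(* Pre- and post-transitions of a place are counted with multiplicity, so all
   arc weights of a causal net are 0 or 1. *)
Record is_causal (C : net A) : Prop := IsCausal {
  causal_preP : forall s : place C, occurrences (preP s) #<= `I_1;
  causal_postP : forall s : place C, occurrences (postP s) #<= `I_1;
  causal_init : forall s : place C,
    init s = `[< forall t : trans C, flowTP t s = 0%N >] :> nat;
  causal_irreflexive : forall x : place C + trans C, ~ flow_plus x x;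
  causal_finite_past : forall t : trans C,
    finite_set [set u : trans C | flow_plus (inr u) (inr t)] }.

(* rho(H) = K *)
Definition image_is (X Y : Type) (rho : X -> Y) (H : X -> nat) (K : Y -> nat) :=
  forall y, [set o | rho o.1 = y] `&` occurrences H #= `I_(K y).

Record is_folding (C N : net A) (rhoP : place C -> place N)
    (rhoT : trans C -> trans N) : Prop := IsFolding {
  folding_label : forall t, label (rhoT t) = label t;
  folding_init : image_is rhoP (@init A C) (@init A N);
  folding_pre : forall t, image_is rhoP (preT t) (preT (rhoT t));
  folding_post : forall t, image_is rhoP (postT t) (postT (rhoT t)) }.

Record process (N : net A) := Process {
  pnet :> net A;
  pnet_causal : is_causal pnet;
  foldP : place pnet -> place N;
  foldT : trans pnet -> trans N;
  process_folding : is_folding foldP foldT }.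

(* The places and transitions of a process form types rather than subsets of a
   common universe, so the inclusions of those of a prefix P' into those of P
   are given explicitly as injections.  [prefix_init] and [prefix_init_sub]
   together say that the initial markings coincide. *)
Record is_prefix (N : net A) (P' P : process N)
    (incP : place P' -> place P) (incT : trans P' -> trans P) : Prop :=
  IsPrefix {
  prefix_injP : injective incP;
  prefix_injT : injective incT;
  prefix_init : forall s, init (incP s) = init s;
  prefix_init_sub : forall s : place P,
    (0 < init s)%N -> exists s', incP s' = s;
  prefix_flowPT : forall s t, flowPT (incP s) (incT t) = flowPT s t;
  prefix_flowTP : forall t s, flowTP (incT t) (incP s) = flowTP t s;
  prefix_foldP : forall s, foldP (incP s) = foldP s;
  prefix_foldT : forall t, foldT (incT t) = foldT t }.

Definition proper_extension (N : net A) (P P' : process N) : Prop :=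
  exists (incP : place P' -> place P) (incT : trans P' -> trans P),
    is_prefix incP incT /\
    ((exists s, forall s', incP s' <> s) \/ (exists t, forall t', incT t' <> t)).

Definition complete (N : net A) (P : process N) : Prop :=
  ~ exists Q : process N, proper_extension Q P.

Definition inevitable (N : net A) (b : A) : Prop :=
  forall P : process N, complete P -> exists t : trans P, label t = b.

Definition causal_net_of (N C : net A) : Prop :=
  exists P : process N, pnet P = C.

Definition caus_equiv (N1 N2 : net A) : Prop :=
  forall C : net A, causal_net_of N1 C <-> causal_net_of N2 C.

End Processes.

Definition respects_inevitability
    (R : forall A : Type, net A -> net A -> Prop) : Prop :=
  forall (A : Type) (N1 N2 : net A) (b : A),
    R A N1 N2 -> inevitable N1 b -> inevitable N2 b.

(* Main.v *)
Require Import Defs.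
From mathcomp Require Import all_boot.
From mathcomp Require Import boolp classical_sets functions cardinality.

Set Implicit Arguments.
Unset Strict Implicit.
Unset Printing Implicit Defensive.

Local Open Scope classical_set_scope.
Local Open Scope card_scope.

(** Both nets have three marked places 0, 1, 2 and transitions without
    postplaces.  [net1] has an [a] consuming {0, 1} and a [b] consuming {2};
    [net2] has in addition an [a] consuming {1, 2}.  A process is a set of
    transitions with pairwise disjoint presets, and its causal net only records
    the labels and the sizes of the presets, so the new [a] is indistinguishable
    from the old one: the causal nets of both nets are those of {}, {a}, {b}
    and {a, b}.  In [net1] nothing competes with [b], so every complete process
    contains it, whereas in [net2] the new [a] alone is a complete process. *)

(** * Cardinalities of fibres of multisets *)

Lemma card_le1P (X : Type) (H : set X) :
  H #<= `I_1 <-> forall x y, H x -> H y -> x = y.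
Proof.
split=> [/pcard_leP[f] x y Hx Hy|Huniq].
  have f0 z : H z -> f z = 0%N.
    by move=> /(@funS _ _ _ _ f) /=; case: (f z).
  apply: (@inj _ _ _ f); rewrite ?inE //.
  exact: etrans (f0 x Hx) (esym (f0 y Hy)).
have [->|/set0P[x Hx]] := eqVneq H set0; first exact: card_ge0.
rewrite -(card_le_eqr (@card_set1 X x)); apply: subset_card_le => y Hy.
exact: Huniq.
Qed.

Lemma image_isP (X Y : Type) (rho : X -> Y) (H : X -> nat) (K : Y -> nat) :
  injective rho -> (forall y, exists x, rho x = y) ->
  image_is rho H K <-> forall x, H x = K (rho x).
Proof.
move=> rho_inj rho_surj.
have fiberE x : [set o | rho o.1 = rho x] `&` occurrences H #= `I_(H x).
  rewrite (_ : _ `&` _ = pair x @` `I_(H x)).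
    by apply: inj_card_eq => i j _ _ [].
  apply/seteqP; split=> [[x' i] /= [/rho_inj -> Hi]|_ [i Hi <-]] //.
  by exists i.
split=> [rhoH x|HK y].
  by apply/card_eq_II; rewrite -(card_eql (fiberE x)); exact: rhoH.
by have [x <-] := rho_surj y; rewrite -HK.
Qed.

Lemma image_is0 (X Y : Type) (rho : X -> Y) (H : X -> nat) (K : Y -> nat) x :
  image_is rho H K -> K (rho x) = 0%N -> H x = 0%N.
Proof.
move=> /(_ (rho x)) + K0; rewrite K0 II0 card_eq0 => /eqP rho0.
case Hx: (H x) => [|n] //; suff: set0 (x, 0%N) by [].
by rewrite -rho0; split; rewrite // /occurrences /= Hx.
Qed.

(** Each fibre of [rho] carries exactly one occurrence: at most one gives injectivity, at least one
    gives surjectivity. *)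
Lemma image_is1 (X Y : Type) (rho : X -> Y) (H : X -> nat) (K : Y -> nat) :
  image_is rho H K -> (forall x, H x = 1%N) -> (forall y, K y = 1%N) ->
  injective rho /\ forall y, exists x, rho x = y.
Proof.
move=> rhoH H1 K1; split=> [x x' rhoxx'|y].
  have := rhoH (rho x); rewrite K1 card_eq_le => /andP[/card_le1P rho1 _].
  have := rho1 (x, 0%N) (x', 0%N).
  rewrite /occurrences /= !H1.
  by move=> /(_ (conj erefl isT) (conj (esym rhoxx') isT)) [].
have [[[x i] [/= <- _]]|noty] :=
  pselect (exists o, ([set o | rho o.1 = y] `&` occurrences H) o).
  by exists x.
have := rhoH y; rewrite K1 (_ : _ `&` _ = set0) => [|].
  rewrite -(card_eqr (card_set1 (x := tt))) card_eq_sym card_eq0.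
  by move=> /eqP/seteqP[/(_ tt)] /(_ erefl).
by apply/seteqP; split=> // o yo; case: noty; exists o.
Qed.

(** Multiplicities are natural numbers, so over finitely many transitions every multiset has
    finitely many occurrences, whatever the marking. *)
Lemma finite_trans_bounded (A : Type) (F : finType) (N : petri_net A)
  (g : trans N -> F) : injective g -> bounded_parallelism N.
Proof.
move=> g_inj [M [U [_ + _]]]; apply.
have -> : occurrences U = \bigcup_(t in setT) (pair t @` `I_(U t)).
  apply/seteqP; split=> [[t i] /= Ui|_ [t _ [i Ui <-]]] //.
  by exists t => //; exists i.
apply: bigcup_finite => [|t _]; last exact/finite_image/finite_II.
rewrite -(preimage_setT g); apply: finite_preimage; last exact: finite_finset.
by move=> x y _ _ /g_inj.
Qed.

(** * Nets in which each place holds one token that is never replaced *)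

Definition one_shot (A : Type) (N : petri_net A) : Prop :=
  [/\ forall s : place N, init s = 1%N,
      forall (t : trans N) (s : place N), flowTP t s = 0%N &
      forall (s : place N) (t : trans N), flowPT s t <= 1].

(** A combinatorial description of the processes of a one-shot net. In [packing_disjoint], the case
    [rhoT t = rhoT u] says that a transition with a nonempty preset occurs at most once. *)
Record is_packing (A : Type) (C N : petri_net A) (rhoP : place C -> place N)
    (rhoT : trans C -> trans N) : Prop := IsPacking {
  packing_one_shot : one_shot C;
  packing_inj : injective rhoP;
  packing_surj : forall s, exists s', rhoP s' = s;
  packing_flow : forall s t, flowPT s t = flowPT (rhoP s) (rhoT t);
  packing_label : forall t, label (rhoT t) = label t;
  packing_disjoint : forall s t u,
    0 < flowPT (rhoP s) (rhoT t) -> 0 < flowPT (rhoP s) (rhoT u) -> t = u }.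

(** A folding reflects the absence of postplaces, so all places of [C] are initially marked;
    comparing initial markings then makes [rhoP] bijective. *)
Lemma one_shot_processP (A : Type) (C N : net A) (rhoP : place C -> place N)
    (rhoT : trans C -> trans N) : one_shot N ->
  is_causal C /\ is_folding rhoP rhoT <-> is_packing rhoP rhoT.
Proof.
move=> [N_init N_post N_le1]; split.
  move=> [[_ C_uniq C_init _ _] [fold_label fold_init fold_pre fold_post]].
  have C_post (t : trans C) s : flowTP t s = 0%N.
    exact: (image_is0 (fold_post t)).
  have C_init1 (s : place C) : init s = 1%N.
    by rewrite C_init; case: asboolP => // -[].
  have [rho_inj rho_surj] := image_is1 fold_init C_init1 N_init.
  have C_flow (s : place C) t : flowPT s t = flowPT (rhoP s) (rhoT t).
    by have /(image_isP _ _ rho_inj rho_surj)/(_ s) := fold_pre t.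
  split=> // [|s t u]; first by split=> // s t; rewrite C_flow.
  rewrite -!C_flow => st su.
  by have /card_le1P/(_ (t, 0%N) (u, 0%N) st su)[] := C_uniq s.
move=> [[C_init C_post C_le1] rho_inj rho_surj C_flow C_label C_disj].
(* Without arcs into places, every flow path is a single arc from a place to a transition;
   irreflexivity and finite pasts follow. *)
have C_plus (x y : place C + trans C) :
    flow_plus x y -> (exists s, x = inl s) /\ (exists t, y = inr t).
  elim=> {x y} [[s|t] [s'|t'] //=|x y z _ [xl _] _ [_ zr]] //.
    by split; [exists s | exists t'].
  by rewrite C_post.
split; split=> //.
- move=> s; apply/card_le1P => -[t i] [u j].
  by rewrite /occurrences /= /preP C_post.
- move=> s; apply/card_le1P => -[t i] [u j].
  rewrite /occurrences /= /postP => si sj.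
  have st := leq_ltn_trans (leq0n _) si; have su := leq_ltn_trans (leq0n _) sj.
  have := C_le1 s t; have := C_le1 s u.
  rewrite (C_disj s t u) -?C_flow // in si *.
  by case: i j si sj => [|i] [|j] //; case: (flowPT s u) => [|[]].
- by move=> s; rewrite C_init; case: asboolP => // -[] t; rewrite C_post.
- by move=> x /C_plus[[s ->] [t]].
- move=> t; rewrite (_ : [set _ | _] = set0) // -subset0 => u /=.
  by move=> /C_plus[[]].
- by apply/image_isP => // s; rewrite C_init N_init.
- by move=> t; apply/image_isP => // s; rewrite /preT C_flow.
- by move=> t; apply/image_isP => // s; rewrite /postT C_post N_post.
Qed.

Lemma process_packing (A : Type) (N : net A) (P : process N) :
  one_shot N -> is_packing (foldP (p := P)) (foldT (p := P)).
Proof.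
move=> /(one_shot_processP (foldP (p := P)) (foldT (p := P)))[+ _]; apply.
by split; [exact: pnet_causal | exact: process_folding].
Qed.

Lemma packing_process (A : Type) (C N : net A) (rhoP : place C -> place N)
    (rhoT : trans C -> trans N) :
  one_shot N -> is_packing rhoP rhoT ->
  exists P : process N, pnet P = C.
Proof.
move=> /(one_shot_processP rhoP rhoT)[_ PP] /PP[C_causal C_fold].
by exists (Process C_causal C_fold).
Qed.

(** * The two nets and their causal nets *)

Definition one_shot_net (A P T : Type) (w : P -> T -> bool) (l : T -> A) :
    petri_net A :=
  PetriNet w (fun _ _ => 0%N) (fun _ => 1%N) l.

Lemma one_shot_netP (A P T : Type) (w : P -> T -> bool) (l : T -> A) :
  one_shot (one_shot_net w l).
Proof. by split=> // s t; exact: leq_b1. Qed.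

(* [true] is the action [b], [false] the action [a]. *)
Definition weight1 (s : 'I_3) (t : bool) : bool :=
  if t then s == 2 :> nat else s < 2.

(** [None] is the additional [a]; hence the labelling [odflt false] below. *)
Definition weight2 (s : 'I_3) (t : option bool) : bool :=
  if t is Some u then weight1 s u else 0 < s.

Definition net1 : net bool :=
  Net (@finite_trans_bounded _ _ (one_shot_net weight1 id) id (fun _ _ => id)).

Definition net2 : net bool :=
  Net (@finite_trans_bounded _ _ (one_shot_net weight2 (odflt false)) id
         (fun _ _ => id)).

Lemma net1_one_shot : one_shot net1.
Proof. exact: one_shot_netP. Qed.

Lemma net2_one_shot : one_shot net2.
Proof. exact: one_shot_netP. Qed.

Definition place0 : 'I_3 := @Ordinal 3 0 isT.
Definition place1 : 'I_3 := @Ordinal 3 1 isT.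
Definition place2 : 'I_3 := @Ordinal 3 2 isT.

Lemma net1_net2_causal_net C : causal_net_of net1 C -> causal_net_of net2 C.
Proof.
move=> [P <-]; have [P1 Pinj Psurj Pflow Plabel Pdisj] :=
  process_packing P net1_one_shot.
apply: (@packing_process _ _ net2 (foldP (p := P)) (Some \o foldT (p := P)) net2_one_shot).
by split.
Qed.

Lemma net2_net1_causal_net C : causal_net_of net2 C -> causal_net_of net1 C.
Proof.
move=> [P <-]; have [P1 Pinj Psurj Pflow Plabel Pdisj] :=
  process_packing P net2_one_shot.
have [[t0 t0N]|noN] := pselect (exists t : trans P, foldT t = None).
  (* The new [a] is in conflict with everything, so it is the only transition;
     reversing the order of the places turns it into the old [a]. *)
  have t0_only t : t = t0.
    have share s : weight2 s (foldT t) -> weight2 s None -> t = t0.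
      have [s' <- wt w0] := Psurj s.
      by apply: (Pdisj s'); rewrite ?t0N; rewrite lt0b.
    (* The new [a] meets [b] in place 2, and the old [a] and itself in place 1. *)
    move: share; case: (foldT t) => [[]|] share.
    - exact: (share place2).
    - exact: (share place1).
    - exact: (share place1).
  apply: (@packing_process _ _ net1 (@rev_ord 3 \o foldP (p := P)) (fun=> false)).
    exact: net1_one_shot.
  split=> //.
  - exact: inj_comp (@rev_ord_inj 3) Pinj.
  - move=> s; have [s' s'E] := Psurj (rev_ord s).
    by exists s'; rewrite /= s'E rev_ordK.
  - move=> s t; rewrite Pflow (t0_only t) t0N /= /weight1 /=.
    by case: (foldP s) => [[|[|[|]]]].
  - by move=> t; rewrite -Plabel (t0_only t) t0N.
  - by move=> s t u _ _; rewrite (t0_only t) (t0_only u).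
(* The default value is never taken, since [None] does not occur. *)
have foldTE (t : trans P) : foldT t = Some (odflt false (foldT t)) :> trans net2.
  by case E: (foldT t) => [//|]; case: noN; exists t.
apply: (@packing_process _ _ net1 (foldP (p := P)) (odflt false \o foldT (p := P))).
  exact: net1_one_shot.
split=> // [s t|s t u].
  by rewrite Pflow foldTE.
by move=> st su; apply: (Pdisj s); rewrite foldTE.
Qed.

(** * Inevitability of [b] *)

Lemma net1_inevitable : inevitable net1 true.
Proof.
move=> P P_complete; apply: contrapT => no_b; apply: P_complete.
have [P1 Pinj Psurj Pflow Plabel Pdisj] :=
  process_packing P net1_one_shot.
have foldTF (t : trans P) : foldT t = false :> trans net1.
  by case E: (foldT t) => //; case: no_b; exists t; rewrite -Plabel.
(* A process without [b] leaves place 2 free, so it is extended by a [b], namely [None]. *)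
pose rhoT (t : option (trans P)) := if t is Some t' then foldT t' else true : trans net1.
pose w (s : place P) (t : option (trans P)) := weight1 (foldP s) (rhoT t).
have rho_inj : injective rhoT.
  (* Two occurrences of [a] would compete for place 0. *)
  have [s sE] := Psurj place0.
  move=> [t|] [u|] //=; rewrite ?foldTF // => _; congr Some.
  by apply: (Pdisj s); rewrite sE foldTF.
pose Q : net bool :=
  Net (@finite_trans_bounded _ _ (one_shot_net w rhoT) rhoT rho_inj).
have Q_packing : @is_packing _ Q net1 (foldP (p := P)) rhoT.
  split=> //; first exact: one_shot_netP.
  move=> s [t|] [u|] //=; rewrite ?foldTF.
  - by move=> st su; congr Some; apply: (Pdisj s); rewrite foldTF.
  - by case: (foldP s) => [[|[|[|]]]].
  - by case: (foldP s) => [[|[|[|]]]].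
have [Q_causal Q_fold] :=
  (one_shot_processP _ _ net1_one_shot).2 Q_packing.
exists (Process Q_causal Q_fold), id, Some; split; last by right; exists None.
have [P_init P_post _] := P1.
split=> //.
by move=> s _; exists s.
Qed.

Lemma net2_not_inevitable : ~ inevitable net2 true.
Proof.
(* The causal net in which only the new [a] occurs. *)
pose C : net bool := Net (@finite_trans_bounded _ _
  (one_shot_net (fun (s : 'I_3) (_ : unit) => 0 < s) (fun=> false)) id
  (fun _ _ => id)).
have C_packing : @is_packing _ C net2 id (fun=> None).
  split=> //; first exact: one_shot_netP.
  - by move=> s; exists s.
  - by move=> s [] [].
have [C_causal C_fold] := (one_shot_processP _ _ net2_one_shot).2 C_packing.
move=> /(_ (Process C_causal C_fold))[|[] //].
move=> [Q [incP [incT [Q_prefix]]]].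
have [[Q_init _ _] Qinj Qsurj Qflow Qlabel Qdisj] := process_packing Q net2_one_shot.
have [_ _ _ init_sub _ _ fold_incP fold_incT] := Q_prefix.
(* Every place of [Q] is initially marked, and a prefix has the same initial marking, so no place is
   new. A new transition would compete with the new [a]. *)
case=> [[s s_new]|[t t_new]].
  by have [|s' /s_new] := init_sub s; rewrite ?Q_init.
have share s : weight2 s (foldT t) -> 0 < s -> incT tt = t.
  have [s' <- wt s_gt0] := Qsurj s.
  by apply: (Qdisj s'); rewrite ?fold_incT lt0b.
apply: (t_new tt); move: share; case: (foldT t) => [[]|] share.
- exact: (share place2).
- exact: (share place1).
- exact: (share place1).
Qed.

Theorem theorem6 :
  ~ respects_inevitability caus_equiv /\
  exists (A : Type) (N1 N2 : net A) (b : A),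
    caus_equiv N1 N2 /\ inevitable N1 b /\ ~ inevitable N2 b.
Proof.
have N12 : caus_equiv net1 net2.
  by split; [exact: net1_net2_causal_net | exact: net2_net1_causal_net].
split=> [respects|].
  exact: net2_not_inevitable (respects _ _ _ _ N12 net1_inevitable).
exists bool, net1, net2, true.
by split; [|split]; [|exact: net1_inevitable|exact: net2_not_inevitable].
Qed.
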